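(* Fix an integer $d \ge 3$. Let $G$ be a random $d$-regular graph on $n$ vertices ($dn$ even), drawn from the configuration model, and let $v$ be a vertex of $G$. Then with probability tending to $1$ as $n \to \infty$, the radius of the largest embedded $d$-regular tree rooted at $v$ is $\left(\tfrac{1}{2}+o(1)\right)\log_{d-1} n$.
   Context: Configuration model: let $W=[n]\times[d]$ (vertex $i$ carries $d$ half-edges $(i,1),\dots,(i,d)$). A configuration is a uniformly random partition of $W$ into $dn/2$ pairs; projecting to $[n]$, vertices $i,j$ are joined by an edge for each pair containing a half-edge of $i$ and a half-edge of $j$. Loops and multiple edges are allowed. A rooted tree (a subgraph of $G$ that is a tree, containing the root $v$) is called $d$-regular if every vertex of it that is not a leaf has degree $d$ in the tree. The radius of a rooted tree is $\max_u \delta(v,u)$ over vertices $u$ of the tree, where $\delta$ is graph distance. ''Almost always'' means with probability tending to $1$ as $n\to\infty$.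
   Formalization: A d-regular tree is also required to have all its leaves at graph distance equal to its radius from the root v (a full ball); if only non-leaf vertices must have degree d, caterpillars along geodesics have radius about log_{d-1} n and the claim fails. *)

(* Defs.v *)
From mathcomp Require Import all_boot all_order all_algebra.
From mathcomp Require Import boolp.

Set Implicit Arguments.
Unset Strict Implicit.
Unset Printing Implicit Defensive.

Notation half_edge n d := ('I_n * 'I_d)%type.

Definition configurations (n d : nat) : {set {set {set half_edge n d}}} :=
  [set P : {set {set half_edge n d}} |
     partition P [set: half_edge n d] & [forall B in P, #|B| == 2]].

(* Probability of E under the uniform distribution on configurations; the
   quotient is 0 / 0 = 0 when there is none, i.e. when d * n is odd. *)
Definition config_prob (R : numFieldType) (n d : nat)
    (E : pred {set {set half_edge n d}}) : R :=
  (#|[set P in configurations n d | E P]|%:R / #|configurations n d|%:R)%R.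

(* The edges of the multigraph on 'I_n are the pairs B of the configuration
   themselves, so parallel edges stay distinct; B is a loop at x when
   joins B x x (for #|B| = 2 this forces the two half-edges to differ). *)
Definition joins (n d : nat) (B : {set half_edge n d}) (x y : 'I_n) : bool :=
  [exists i : 'I_d, exists j : 'I_d, B == [set (x, i); (y, j)]].

Definition adj (n d : nat) (F : {set {set half_edge n d}}) : rel 'I_n :=
  fun x y => [exists B in F, joins B x y].

Definition degree (n d : nat) (F : {set {set half_edge n d}}) (x : 'I_n) : nat :=
  #|[set h in cover F | h.1 == x]|.

(* Length of a shortest path from x to y; the value is n when y is not
   reachable from x. *)
Definition gdist (n d : nat) (F : {set {set half_edge n d}}) (x y : 'I_n) : nat :=
  find (fun k => [exists p : k.-tuple 'I_n, path (adj F) x p && (last x p == y)])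
       (iota 0 n).

(* Vertices and edges of a subgraph. *)
Definition subgraph (n d : nat) := ({set 'I_n} * {set {set half_edge n d}})%type.

Definition is_subgraph (n d : nat) (P : {set {set half_edge n d}})
    (T : subgraph n d) : Prop :=
  T.2 \subset P /\ (forall h, h \in cover T.2 -> h.1 \in T.1).

(* A cycle x_0 -B_0- x_1 -B_1- ... -B_(k-1)- x_0 with k >= 1, distinct vertices
   and distinct edges; loops (k = 1) and double edges (k = 2) are cycles. *)
Definition is_cycle (n d : nat) (F : {set {set half_edge n d}})
    (p : seq ('I_n * {set half_edge n d})) : Prop :=
  [/\ p <> [::], uniq (unzip1 p), uniq (unzip2 p),
      {subset unzip2 p <= F} & cycle (fun a b => joins a.2 a.1 b.1) p].

Definition is_tree (n d : nat) (T : subgraph n d) : Prop :=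
  {in T.1 &, forall x y, connect (adj T.2) x y} /\
  (forall p, ~ is_cycle T.2 p).

(* Distances are measured in the ambient graph P. *)
Definition radius (n d : nat) (P : {set {set half_edge n d}}) (v : 'I_n)
    (T : subgraph n d) : nat :=
  \max_(u in T.1) gdist P v u.

(* Degree 0 only occurs for the one-vertex tree. *)
Definition is_leaf (n d : nat) (T : subgraph n d) (u : 'I_n) : Prop :=
  u \in T.1 /\ degree T.2 u <= 1.

(* The last clause says that the tree is a full ball of the infinite d-regular
   tree: branches are not allowed to stop before the outermost level. Without
   it a path with pendant edges would qualify, and the largest radius would be
   of the order of the diameter. *)
Definition regular_tree_at (n d : nat) (P : {set {set half_edge n d}}) (v : 'I_n)
    (T : subgraph n d) : Prop :=
  [/\ is_subgraph P T, is_tree T, v \in T.1,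
      (forall u, u \in T.1 -> ~ is_leaf T u -> degree T.2 u = d) &
      (forall u, is_leaf T u -> gdist P v u = radius P v T)].

(* The one-vertex tree is always admissible, so the maximum is attained. *)
Definition largest_radius (n d : nat) (P : {set {set half_edge n d}})
    (v : 'I_n) : nat :=
  \max_(T : subgraph n d | `[< regular_tree_at P v T >]) radius P v T.

(* Main.v *)
(* Explore the graph from [v] by breadth-first search, revealing the partner of
   one half-edge at a time.  The largest regular tree at [v] has radius at least
   [r] exactly when the first [e_r] partners lie at distinct new vertices, where
   [e_r] is the number of edges of the [d]-regular tree of radius [r].  A
   sequence of [k] such partners fixes [k] pairs of the configuration, and the
   number of perfect matchings containing [k] given pairs does not depend on the
   pairs.  Hence the probability that the first [k] steps succeed is exactly
   [\prod_(i < k) d (n - 1 - i) / (d n - 2 i - 1)]; it is at least [1 - 2 k^2 / n]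
   and at most of order [n / k^2].  As [e_r] is of order [(d - 1)^r], it crosses
   [sqrt n] at [r = log_(d-1) n / 2], and a window of width [sqrt (ln n)] around
   this value is enough. *)
Require Import Defs.
From mathcomp Require Import all_boot all_order all_algebra.
From mathcomp Require Import boolp zify ring lra.

Set Implicit Arguments.
Unset Strict Implicit.
Unset Printing Implicit Defensive.

(** Double counting: when each [x] has at most one witness, the classes are disjoint. The witness is
    first the partner of a point, later the list of partners of a search. *)
Lemma card_unique_witness (T I : finType) (A : pred I) (F : I -> pred T) :
  (forall x i j, A i -> A j -> F i x -> F j x -> i = j) ->
  #|[set x | [exists i, A i && F i x]]| = \sum_(i | A i) #|[set x | F i x]|.
Proof.
move=> uniqF; rewrite -sum1_card.
rewrite (eq_bigr (fun i => \sum_x (F i x : nat))); last first.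
  by move=> i _; rewrite -sum1dep_card big_mkcond; apply: eq_bigr => x _; case: (F i x).
rewrite exchange_big big_mkcond; apply: eq_bigr => x _ /=; rewrite inE.
case: existsP => [[i /andP[Ai Fi]]|noF]; last first.
  rewrite big1// => i Ai; case E: (F i x) => //.
  by case: noF; exists i; rewrite Ai.
rewrite (bigD1 i)//= Fi big1// => j /andP[Aj ji].
case E: (F j x) => //.
by rewrite (uniqF _ _ _ Aj Ai E Fi) eqxx in ji.
Qed.

(** * Perfect matchings *)

Section Matchings.
Variable W : finType.
Implicit Types (P Q : {set {set W}}) (a b c : W).

(* [configurations n d] is convertible to [matchings (half_edge n d)]. *)
Definition matchings : {set {set {set W}}} :=
  [set P : {set {set W}} | partition P [set: W] & [forall B in P, #|B| == 2]].

Definition partial_matching Q := trivIset Q && [forall B in Q, #|B| == 2].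

Lemma matching_card P B : P \in matchings -> B \in P -> #|B| = 2.
Proof. by rewrite inE => /andP[_ /forall_inP h] /h /eqP. Qed.

Lemma matching_trivIset P : P \in matchings -> trivIset P.
Proof. by rewrite inE => /andP[/partition_trivIset]. Qed.

Lemma matching_neq {P a b} : P \in matchings -> [set a; b] \in P -> a != b.
Proof. by move=> PM /(matching_card PM); rewrite cards2; case: eqP. Qed.

Lemma matching_block P B a :
  P \in matchings -> B \in P -> a \in B -> exists b, B = [set a; b].
Proof.
move=> PM BP aB; have /eqP/cards2P[x [y [_ defB]]] := matching_card PM BP.
move: aB; rewrite {}defB in_set2 => /orP[] /eqP ->; first by exists y.
by exists x; rewrite setUC.
Qed.

Lemma matching_partner P a : P \in matchings -> exists b, [set a; b] \in P.
Proof.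
move=> PM; have /cover_partition covP : partition P [set: W].
  by move: PM; rewrite inE => /andP[].
have: a \in cover P by rewrite covP inE.
case/bigcupP=> B BP aB; have [b defB] := matching_block PM BP aB.
by exists b; rewrite -defB.
Qed.

Lemma matching_same_block {P a B C} : P \in matchings ->
  B \in P -> C \in P -> a \in B -> a \in C -> B = C.
Proof.
move=> /matching_trivIset tP BP CP aB aC.
by rewrite -(def_pblock tP BP aB) -(def_pblock tP CP aC).
Qed.

Lemma matching_partner_uniq {P a b c} : P \in matchings ->
  [set a; b] \in P -> [set a; c] \in P -> b = c.
Proof.
move=> PM abP acP.
have eqB := matching_same_block PM abP acP (set21 a b) (set21 a c).
have: b \in [set a; c] by rewrite -eqB set22.
by rewrite !inE eq_sym (negPf (matching_neq PM abP)) => /eqP.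
Qed.

Lemma card_cover_partial Q : partial_matching Q -> #|cover Q| = #|Q|.*2.
Proof.
case/andP=> /eqP <- /forall_inP Q2.
rewrite (eq_bigr (fun _ => 2)) => [|B /Q2/eqP //].
by rewrite sum_nat_const muln2.
Qed.

Lemma partial_matchingU1 Q a b : partial_matching Q -> a \notin cover Q ->
  b \notin cover Q -> a != b ->
  partial_matching ([set a; b] |: Q) /\ #|[set a; b] |: Q| = #|Q|.+1.
Proof.
move=> /andP[tQ /forall_inP Q2] aQ bQ ab.
have abQ : [set a; b] \notin Q.
  by apply: contra aQ => h; apply/bigcupP; exists [set a; b]; rewrite ?set21.
split; last by rewrite cardsU1 abQ.
apply/andP; split; last first.
  by apply/forall_inP => B; rewrite !inE => /orP[/eqP->|/Q2//]; rewrite cards2 ab.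
apply/trivIsetP => B C; rewrite !inE => BQ CQ neBC.
have disj D : D \in Q -> [disjoint [set a; b] & D].
  move=> DQ; rewrite disjoints_subset; apply/subsetP => x; rewrite !inE => xab.
  apply/negP => xD; move: aQ bQ; case/orP: xab => /eqP <-.
    by move=> /bigcupP[]; exists D.
  by move=> _ /bigcupP[]; exists D.
case/orP: BQ => [/eqP defB|BQ]; case/orP: CQ => [/eqP defC|CQ].
- by rewrite defB defC eqxx in neBC.
- by rewrite defB disj.
- by rewrite disjoint_sym defC disj.
- by move/trivIsetP: tQ; apply.
Qed.

(** Fix an uncovered point: its partner can be any of the other [2 j - 1] uncovered points, and each
    choice extends [Q] by one pair. The product is the double factorial [(2 j - 1)!!]. *)
Lemma card_matchings_ext Q j : partial_matching Q -> #|W| = #|Q|.*2 + j.*2 ->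
  #|[set P in matchings | Q \subset P]| = \prod_(i < j) i.*2.+1.
Proof.
elim: j Q => [|j IHj] Q pQ cardW.
  rewrite big_ord0 addn0 in cardW *.
  have covQ : cover Q = [set: W].
    by apply/eqP; rewrite eqEcard subsetT cardsT (card_cover_partial pQ) cardW leqnn.
  apply/eqP/cards1P; exists Q; apply/setP => P; rewrite inE [in RHS]inE.
  have /andP[tQ Q2] := pQ.
  have QM : Q \in matchings.
    rewrite inE Q2 andbT /partition covQ eqxx tQ /=.
    by apply/negP => /(forall_inP Q2); rewrite cards0.
  apply/andP/eqP => [[PM sQP]|->]; last by [].
  apply/eqP; rewrite eqEsubset sQP andbT; apply/subsetP => B BP.
  have /card_gt0P[a aB] : 0 < #|B| by rewrite (matching_card PM BP).
  have: a \in cover Q by rewrite covQ inE.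
  case/bigcupP => C CQ aC.
  by rewrite (matching_same_block PM BP (subsetP sQP _ CQ) aB aC).
have [a aQ] : exists a, a \notin cover Q.
  apply/existsP; rewrite -negb_forall; apply/negP => /forallP allQ.
  have : #|cover Q| = #|W| by apply: eq_card => x; rewrite allQ inE.
  by rewrite (card_cover_partial pQ) cardW; lia.
pose A b := (b \notin cover Q) && (a != b).
pose F b : pred {set {set W}} := fun P => (P \in matchings) && ([set a; b] |: Q \subset P).
have -> : [set P in matchings | Q \subset P] = [set P | [exists b, A b && F b P]].
  apply/setP => P; rewrite [LHS]inE [RHS]inE /F; apply/andP/existsP; last first.
    by case=> b /andP[_ /andP[-> ]]; rewrite subUset => /andP[].
  case=> PM sQP.
  have [b abP] := matching_partner a PM; exists b.
  rewrite PM subUset sQP sub1set abP /A (matching_neq PM abP) !andbT.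
  apply/negP => /bigcupP[B BQ bB].
  have eqB := matching_same_block PM (subsetP sQP _ BQ) abP bB (set22 a b).
  by case/negP: aQ; apply/bigcupP; exists B; rewrite // eqB set21.
rewrite card_unique_witness; last first.
  move=> P b c _ _ /andP[PM]; rewrite subUset sub1set => /andP[bP _].
  case/andP=> _; rewrite subUset sub1set => /andP[cP _].
  exact: (matching_partner_uniq PM bP cP).
rewrite (eq_bigr (fun=> \prod_(i < j) i.*2.+1)); last first.
  move=> b /andP[bQ ab]; have [pQ' cQ'] := partial_matchingU1 pQ aQ bQ ab.
  by rewrite -(IHj _ pQ'); last rewrite cardW cQ'; [|lia].
rewrite sum_nat_const big_ord_recr /= mulnC; congr (_ * _)%N.
have -> : #|A| = #|~: cover Q :\ a| by apply: eq_card => b; rewrite !inE /A andbC eq_sym.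
have := cardsD1 a (~: cover Q); rewrite inE aQ.
have := cardsC (cover Q); rewrite (card_cover_partial pQ) cardW.
lia.
Qed.

End Matchings.
(** * Breadth-first search *)

Section Exploration.
Variables n d : nat.
Hypothesis d_gt2 : 2 < d.
Implicit Types (P F : {set {set half_edge n d}}) (v x : 'I_n).
Implicit Types (h y q : half_edge n d) (ys : seq (half_edge n d)).

Definition halves (xs : seq 'I_n) : seq (half_edge n d) :=
  [seq (x, i) | x <- xs, i <- enum 'I_d].

Definition others h := rem h (halves [:: h.1]).

(* [ys] lists the partners found so far, and the
   half-edge processed at step [i] is the [i]-th entry of the queue. *)
Definition queue v ys := halves [:: v] ++ flatten (map others ys).

Definition reached v ys := v :: unzip1 ys.

Definition edges v ys := [seq [set z.1; z.2] | z <- zip (queue v ys) ys].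

(** The queue is always longer than [ys], so the default [y] is never returned and the value is the
    same for every [y]. *)
Definition frontier v ys y := nth y (queue v ys) (size ys).

Lemma mem_halves xs h : (h \in halves xs) = (h.1 \in xs).
Proof.
case: h => x i; apply/allpairsP/idP => /= [[[a b] [/= aX _ [-> _]]] //|xX].
by exists (x, i); rewrite xX mem_enum.
Qed.

Lemma halves_uniq xs : uniq xs -> uniq (halves xs).
Proof. by move=> uX; apply: allpairs_uniq; rewrite ?enum_uniq // => -[a b] [a' b']. Qed.

Lemma halves_cons x xs : halves (x :: xs) = halves [:: x] ++ halves xs.
Proof. by rewrite /halves /= cats0. Qed.

Lemma size_halves1 x : size (halves [:: x]) = d.
Proof. by rewrite size_allpairs size_enum_ord mul1n. Qed.

Lemma size_others h : size (others h) = d.-1.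
Proof. by rewrite size_rem ?size_halves1 // mem_halves mem_head. Qed.

Lemma size_queue v ys : size (queue v ys) = d + size ys * d.-1.
Proof.
rewrite size_cat size_halves1; congr (_ + _).
by elim: ys => //= y ys IH; rewrite size_cat IH size_others mulSn.
Qed.

Lemma size_queue_gt v ys : size ys < size (queue v ys).
Proof. by rewrite size_queue; nia. Qed.

Lemma queue_rcons v ys y : queue v (rcons ys y) = queue v ys ++ others y.
Proof. by rewrite /queue map_rcons flatten_rcons catA. Qed.

Lemma queue_take v ys k :
  queue v ys = queue v (take k ys) ++ flatten (map others (drop k ys)).
Proof. by rewrite /queue -[in LHS](cat_take_drop k ys) map_cat flatten_cat catA. Qed.

Lemma reached_rcons v ys y : reached v (rcons ys y) = rcons (reached v ys) y.1.
Proof. by rewrite /reached /unzip1 map_rcons. Qed.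

(** Invariant of the search: the half-edges of a newly found vertex are the partner [y] that led to
    it and the [others y] put into the queue. *)
Lemma perm_queue v ys : perm_eq (queue v ys ++ ys) (halves (reached v ys)).
Proof.
rewrite /queue /reached (halves_cons v (unzip1 ys)) -catA perm_cat2l.
elim: ys => //= y ys IH; rewrite (halves_cons y.1).
rewrite -[y :: ys]cat1s perm_catACA; apply: perm_cat => //.
rewrite perm_catC perm_sym perm_to_rem // mem_halves.
exact: mem_head.
Qed.

Lemma mem_queue v ys h :
  (h \in queue v ys) || (h \in ys) = (h.1 \in reached v ys).
Proof. by rewrite -mem_cat (perm_mem (perm_queue v ys)) mem_halves. Qed.

Lemma queue_uniq v ys : uniq (reached v ys) -> uniq (queue v ys ++ ys).
Proof. by move=> uR; rewrite (perm_uniq (perm_queue v ys)) halves_uniq. Qed.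

Lemma edges_nil v : edges v [::] = [::].
Proof. by rewrite /edges; case: (queue v [::]). Qed.

Lemma edges_rcons v ys y :
  edges v (rcons ys y) = rcons (edges v ys) [set frontier v ys y; y].
Proof.
rewrite /edges /frontier queue_rcons.
elim: ys (queue v ys) (size_queue_gt v ys) => [|y' ys IH] [|q qs] //= lt_sz.
  by case: (_ ++ _); case: qs {lt_sz}.
by rewrite IH.
Qed.

Lemma edge_nth v ys h i : i < size ys ->
  [set nth h (queue v ys) i; nth h ys i] \in edges v ys.
Proof.
move=> lti; have lt' := ltn_trans lti (size_queue_gt v ys).
have ltz : i < size (zip (queue v ys) ys) by rewrite size_zip leq_min lt' lti.
apply/(nthP set0); exists i; first by rewrite size_map.
by rewrite (nth_map (h, h)) // nth_zip_cond ltz.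
Qed.

Lemma mem_cover_edges v ys h : (h \in cover [set:: edges v ys]) =
  (h \in take (size ys) (queue v ys)) || (h \in ys).
Proof.
have E (qs : seq (half_edge n d)) : size ys < size qs ->
  (h \in cover [set:: [seq [set z.1; z.2] | z <- zip qs ys]]) =
  (h \in take (size ys) qs) || (h \in ys).
  elim: ys qs => [|y ys IH] [|q qs] //=.
    move=> _; apply/bigcupP => -[B].
    by rewrite inE.
  rewrite ltnS => /IH; rewrite !in_cons orbACA => <-.
  apply/bigcupP/orP => [[B]|[]].
  - rewrite inE in_cons => /orP[/eqP ->|BE hB]; first by rewrite !inE; left.
    by right; apply/bigcupP; exists B; rewrite ?inE.
  - by exists [set q; y]; rewrite !inE ?eqxx.
  - by case/bigcupP => B; rewrite inE => BE hB; exists B; rewrite // inE in_cons BE orbT.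
exact/E/size_queue_gt.
Qed.

(** With distinct reached vertices [queue v ys ++ ys] has no repetition, and the frontier sits right
    behind the processed prefix of the queue. *)
Lemma frontier_fresh v ys y : uniq (reached v ys) ->
  frontier v ys y \notin cover [set:: edges v ys].
Proof.
move=> /queue_uniq; have lt_sz := size_queue_gt v ys.
rewrite -{1}(cat_take_drop (size ys) (queue v ys)) cat_uniq (drop_nth y) //.
rewrite mem_cover_edges -/(frontier v ys y) => /and3P[+ /hasPn nys _].
rewrite cat_uniq => /and3P[_ /hasPn /(_ _ (mem_head _ _)) /= /negPf -> _] /=.
apply/negP => /nys /=; rewrite mem_cat mem_head orbT.
by [].
Qed.

Lemma mem_frontier v ys y : (frontier v ys y).1 \in reached v ys.
Proof. by rewrite -mem_queue mem_nth // size_queue_gt. Qed.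

Lemma cover_reached v ys h : h \in cover [set:: edges v ys] -> h.1 \in reached v ys.
Proof.
by rewrite mem_cover_edges -mem_queue => /orP[/mem_take ->|->]; rewrite ?orbT.
Qed.

Lemma edges_rcons_set v ys y : [set:: edges v (rcons ys y)] =
  [set frontier v ys y; y] |: [set:: edges v ys].
Proof. by apply/setP => B; rewrite !inE edges_rcons mem_rcons in_cons. Qed.

Lemma edges_partial v ys : uniq (reached v ys) ->
  partial_matching [set:: edges v ys] /\ #|[set:: edges v ys]| = size ys.
Proof.
elim/last_ind: ys => [|ys y IH].
  move=> _; have -> : [set:: edges v [::]] = set0.
    by apply/setP => B; rewrite !inE edges_nil.
  rewrite cards0; split=> //; apply/andP; split; last by apply/forall_inP => B; rewrite inE.
  by apply/trivIsetP => B C; rewrite inE.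
rewrite reached_rcons rcons_uniq edges_rcons_set size_rcons => /andP[yR uR].
have [pE cE] := IH uR.
have fy : frontier v ys y != y.
  by apply: contra yR => /eqP {1}<-; apply: mem_frontier.
have yE : y \notin cover [set:: edges v ys] by apply: contra yR; apply: cover_reached.
by rewrite -cE; apply: partial_matchingU1 => //; apply: frontier_fresh.
Qed.

(** The configuration dictates the search: the frontier is determined by the earlier partners, and
    its own partner in [P] is unique. *)
Lemma edges_inj v ys zs P : P \in configurations n d -> size ys = size zs ->
  {subset edges v ys <= P} -> {subset edges v zs <= P} -> ys = zs.
Proof.
move=> PM; elim/last_ind: ys zs => [|ys y IH] zs; first by case: zs.
case/lastP: zs => [|zs z]; rewrite !size_rcons // => -[eq_sz].
rewrite !edges_rcons => yP zP.
have eq_s : ys = zs.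
  by apply: IH => // B BE; [apply: yP | apply: zP]; rewrite mem_rcons in_cons BE orbT.
rewrite -{}eq_s in zP *; congr rcons.
have eq_f : frontier v ys y = frontier v ys z.
  by apply: set_nth_default; apply: size_queue_gt.
apply: (matching_partner_uniq PM (a := frontier v ys y)).
  by apply: yP; rewrite mem_rcons mem_head.
by rewrite eq_f; apply: zP; rewrite mem_rcons mem_head.
Qed.

(** * Counting the configurations on which the search succeeds *)

Definition explores P v k :=
  [exists ys : k.-tuple (half_edge n d),
     uniq (reached v ys) && all (mem P) (edges v ys)].

Lemma exploresP P v k :
  reflect (exists2 ys, size ys = k & uniq (reached v ys) /\ {subset edges v ys <= P})
          (explores P v k).
Proof.
apply: (iffP existsP) => [[ys /andP[uR /allP sP]]|[ys sz [uR sP]]].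
  by exists ys; rewrite ?size_tuple.
have szb : size ys == k by apply/eqP.
by exists (Tuple szb); rewrite uR; apply/allP.
Qed.

Lemma card_explores v k :
  #|[set P in configurations n d | explores P v k]| =
  \sum_(ys : k.-tuple (half_edge n d) | uniq (reached v ys))
    #|[set P in configurations n d | [set:: edges v ys] \subset P]|.
Proof.
rewrite -(@card_unique_witness _ _ (fun ys : k.-tuple _ => uniq (reached v ys))
  (fun (t : k.-tuple _) P => (P \in configurations n d) && ([set:: edges v t] \subset P))).
  apply: eq_card => P; rewrite [LHS]inE [RHS]inE.
  apply/andP/existsP => [[PM /existsP[ys /andP[uR sP]]]|[ys /and3P[uR PM sP]]].
    exists ys; rewrite uR PM; apply/subsetP => B; rewrite inE.
    by move/allP: sP; apply.
  split=> //; apply/existsP; exists ys; rewrite uR; apply/allP => B BE.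
  by apply: (subsetP sP); rewrite inE.
move=> P ys zs _ _ /andP[PM yP] /andP[_ zP]; apply/val_inj.
apply: (edges_inj (P := P) (v := v)) => //=; first by rewrite !size_tuple.
  by move=> B BE; apply: (subsetP yP); rewrite inE.
by move=> B BE; apply: (subsetP zP); rewrite inE.
Qed.

(** A list splits into its vertices, an injective sequence avoiding [v], and its labels in ['I_d],
    which are arbitrary. *)
Lemma card_reached_uniq v k :
  #|[pred t : k.-tuple (half_edge n d) | uniq (reached v t)]| = (d ^ k * n.-1 ^_ k)%N.
Proof.
pose f (t : k.-tuple (half_edge n d)) := ([tuple of map fst t], [tuple of map snd t]).
pose A := [set t : k.-tuple 'I_n | all (predC1 v) t & uniq t].
have bij_f : bijective f.
  pose g (u : k.-tuple 'I_n * k.-tuple 'I_d) : k.-tuple (half_edge n d) :=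
    [tuple of zip u.1 u.2].
  exists g => [t|[a b]].
    by apply: val_inj; rewrite /= zip_unzip.
  apply/eqP; rewrite xpair_eqE -!val_eqE /=; apply/andP.
  by rewrite -!/(unzip1 _) -!/(unzip2 _) ?unzip1_zip ?unzip2_zip ?size_tuple.
have -> : #|[pred t : k.-tuple (half_edge n d) | uniq (reached v t)]|
          = #|f @^-1: setX A [set: k.-tuple 'I_d]|.
  apply: eq_card => t; rewrite !inE andbT /=; congr andb.
  by rewrite -has_pred1 -all_predC; apply: eq_all.
rewrite on_card_preimset; last first.
  by case: bij_f => g fK gK; exists g => u _; [apply: fK | apply: gK].
rewrite cardsX cardsT card_tuple card_ord mulnC card_uniq_tuples; congr (_ * _ ^_ _)%N.
by rewrite cardC1 card_ord.
Qed.

Lemma card_explores_mul v k m : (n * d = m.*2 + k.*2)%N ->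
  #|[set P in configurations n d | explores P v k]| =
  (d ^ k * n.-1 ^_ k * \prod_(i < m) i.*2.+1)%N.
Proof.
move=> nd; rewrite card_explores -(card_reached_uniq v k) -sum_nat_const.
apply: eq_bigr => t uR; have [pE cE] := edges_partial uR.
by apply: card_matchings_ext => //; rewrite cE size_tuple card_prod !card_ord nd addnC.
Qed.

(** * The search tree as a regular tree *)

(** The number of edges of the [d]-regular tree of radius [s]: after [ball_edges s] partners the
    queue has [d + ball_edges s * d.-1] entries, and each gives one edge of the next ball. *)
Fixpoint ball_edges s := if s is s'.+1 then d + ball_edges s' * d.-1 else 0.

Definition ball v ys s := reached v (take (ball_edges s) ys).

Lemma ball_edges_lt s : ball_edges s < ball_edges s.+1.
Proof. by rewrite /=; nia. Qed.

Lemma ball_edges_ge s : s <= ball_edges s.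
Proof. by elim: s => // s IH; apply: leq_ltn_trans IH (ball_edges_lt s). Qed.

Lemma ball_edges_le s t : s <= t -> ball_edges s <= ball_edges t.
Proof.
elim: t => [|t IH]; first by rewrite leqn0 => /eqP->.
rewrite leq_eqVlt => /orP[/eqP->//|/IH le_st].
exact: leq_trans le_st (ltnW (ball_edges_lt t)).
Qed.

Lemma ball_mono v ys s t : s <= t -> {subset ball v ys s <= ball v ys t}.
Proof.
move=> /ball_edges_le le_st x; rewrite !in_cons => /orP[->//|/mapP[y yt ->]].
apply/orP; right; apply: map_f; move: yt.
by rewrite -[X in take X](minn_idPl le_st) take_min; apply: mem_take.
Qed.

Lemma size_queue_ball v ys s : ball_edges s <= size ys ->
  size (queue v (take (ball_edges s) ys)) = ball_edges s.+1.
Proof. by move=> le_s; rewrite size_queue size_takel. Qed.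

(** The entry processed at a step before [ball_edges s.+1] was already queued once the first
    [ball_edges s] partners were known. *)
Lemma nth_queue_ball v ys h i s : i <= size ys -> i < ball_edges s.+1 ->
  nth h (queue v ys) i \in queue v (take (ball_edges s) ys).
Proof.
move=> le_i lt_i; rewrite (queue_take v ys (ball_edges s)) nth_cat.
have lti : i < size (queue v (take (ball_edges s) ys)).
  have [le_s|lt_s] := leqP (ball_edges s) (size ys); first by rewrite size_queue_ball.
  by rewrite take_oversize ?(ltnW lt_s) //; apply: leq_ltn_trans (size_queue_gt v ys).
by rewrite lti mem_nth.
Qed.

Lemma ball_parent v ys y s : y \in take (ball_edges s.+1) ys ->
  exists2 q, q.1 \in ball v ys s & [set q; y] \in edges v ys.
Proof.
move=> /(nthP y)[i]; rewrite size_take_min leq_min => /andP[lt_e lt_sz].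
rewrite nth_take // => <-; exists (nth y (queue v ys) i); last exact: edge_nth.
by rewrite -mem_queue nth_queue_ball // ltnW.
Qed.

(** * Adjacency and graph distance *)

Lemma joins_pair q y : joins [set q; y] q.1 y.1.
Proof.
by apply/existsP; exists q.2; apply/existsP; exists y.2; rewrite -!surjective_pairing.
Qed.

Lemma joins_sym (B : {set half_edge n d}) x x' : joins B x x' = joins B x' x.
Proof.
by apply/existsP/existsP => -[i /existsP[j /eqP->]]; exists j; apply/existsP;
  exists i; rewrite setUC.
Qed.

Lemma joins_mem (B : {set half_edge n d}) x x' :
  joins B x x' -> exists2 h, h \in B & h.1 = x.
Proof. by case/existsP => i /existsP[j /eqP->]; exists (x, i); rewrite ?set21. Qed.

Lemma joins_end (B : {set half_edge n d}) x x' h :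
  joins B x x' -> h \in B -> h.1 = x \/ h.1 = x'.
Proof.
case/existsP => i /existsP[j /eqP->]; rewrite in_set2 => /orP[] /eqP ->; first by left.
by right.
Qed.

Lemma adj_sym F : symmetric (adj F).
Proof. by move=> x x'; apply: eq_existsb => B; rewrite joins_sym. Qed.

Lemma adj_sub F P : F \subset P -> subrel (adj F) (adj P).
Proof.
move=> /subsetP sFP x x' /existsP[B /andP[BF J]].
by apply/existsP; exists B; rewrite sFP.
Qed.

Lemma gdist_le F x p : path (adj F) x p -> gdist F x (last x p) <= size p.
Proof.
move=> xp; rewrite leqNgt; apply/negP => lt_p.
have lt_n : size p < n.
  by apply: leq_trans lt_p _; apply: leq_trans (find_size _ _) _; rewrite size_iota.
have := before_find 0 lt_p; rewrite nth_iota // add0n /= => /negbT/negP; apply.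
by apply/existsP; exists (in_tuple p); rewrite xp eqxx.
Qed.

Lemma gdist_ge F x x' k : k <= n ->
  (forall p, path (adj F) x p -> last x p = x' -> k <= size p) -> k <= gdist F x x'.
Proof.
move=> le_n le_p; rewrite /gdist; set a := fun _ => _.
(* If no walk is found, [find] returns the length [n] of the list; [k <= n] settles this case. *)
have [has_a|no_a] := boolP (has a (iota 0 n)); last first.
  by move: no_a; rewrite has_find -leqNgt size_iota; apply: leq_trans.
have lt_n : find a (iota 0 n) < n by rewrite -{2}(size_iota 0 n) -has_find.
have := nth_find 0 has_a; rewrite nth_iota // => /existsP[p /andP[xp /eqP px]].
by have := le_p _ xp px; rewrite size_tuple.
Qed.

Lemma gdist_ball P v ys s x : {subset edges v ys <= P} ->
  x \in ball v ys s -> gdist P v x <= s.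
Proof.
move=> sP xs; suff [p [vp <- sz]] : exists p, [/\ path (adj P) v p, last v p = x & size p <= s].
  exact: leq_trans (gdist_le vp) sz.
elim: s x xs => [|s IH] x.
  by rewrite /ball take0 mem_seq1 => /eqP->; exists [::].
rewrite in_cons => /orP[/eqP->|/mapP[y ys' ->]]; first by exists [::].
have [q /IH[p [vp pq sz]] qE] := ball_parent v ys'.
exists (rcons p y.1); rewrite rcons_path last_rcons size_rcons vp pq; split=> //=.
by apply/existsP; exists [set q; y]; rewrite sP // joins_pair.
Qed.

(** A half-edge at [x] is a queue entry, matched to the entry of [ys] with the same index, or an
    entry of [ys], matched to the queue entry with the same index. The index bounds put the partner
    in the next ball. *)
Lemma adj_ball P v ys s x x' : P \in configurations n d -> {subset edges v ys <= P} ->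
  ball_edges s.+1 <= size ys -> x \in ball v ys s -> adj P x x' -> x' \in ball v ys s.+1.
Proof.
move=> PM sP le_sz xs /existsP[B /andP[BP /existsP[i /existsP[j /eqP defB]]]].
have le_s := leq_trans (ltnW (ball_edges_lt s)) le_sz.
rewrite {}defB in BP; set h := (x, i) in BP; set h' := (x', j) in BP.
have : (h \in queue v (take (ball_edges s) ys)) || (h \in take (ball_edges s) ys).
  by rewrite mem_queue.
case/orP => [/(nthP h)[k]|/(nthP h)[k]].
  rewrite size_queue_ball // => lt_k eq_k.
  have lt_sz := leq_trans lt_k le_sz.
  have := sP _ (edge_nth v h lt_sz).
  have -> : nth h (queue v ys) k = h.
    by rewrite (queue_take v ys (ball_edges s)) nth_cat size_queue_ball // lt_k.
  move=> /(matching_partner_uniq PM BP) eq_h'.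
  rewrite in_cons -[x']/(h'.1) eq_h' map_f ?orbT //.
  by rewrite -(nth_take h lt_k) mem_nth // size_takel.
rewrite size_takel // => lt_k; rewrite nth_take // => eq_k.
have lt_sz := leq_trans lt_k le_s.
have := sP _ (edge_nth v h lt_sz); rewrite eq_k setUC.
move=> /(matching_partner_uniq PM BP) eq_h'.
apply: (ball_mono (leqnSn s)); rewrite -[x']/(h'.1) eq_h' -mem_queue.
rewrite nth_queue_ball // ?(ltnW lt_sz) //.
exact: ltn_trans lt_k (ball_edges_lt s).
Qed.

Lemma path_ball P v ys p : P \in configurations n d -> {subset edges v ys <= P} ->
  ball_edges (size p) <= size ys -> path (adj P) v p -> last v p \in ball v ys (size p).
Proof.
move=> PM sP; elim/last_ind: p => [|p x IH]; first by rewrite mem_head.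
rewrite size_rcons rcons_path last_rcons => le_sz /andP[vp px].
apply: (adj_ball PM sP le_sz _ px); apply: IH => //.
exact: leq_trans (ltnW (ball_edges_lt _)) le_sz.
Qed.

(** The tree path gives the upper bound; by [path_ball], a walk of length at most [r] from [v] would
    end in the ball of radius [r]. *)
Lemma gdist_sphere P v ys r x : P \in configurations n d -> {subset edges v ys <= P} ->
  uniq (reached v ys) -> size ys = ball_edges r.+1 ->
  x \in reached v ys -> x \notin ball v ys r -> gdist P v x = r.+1.
Proof.
move=> PM sP uR sz xR xNr; apply/eqP; rewrite eqn_leq; apply/andP; split.
  by apply: (gdist_ball sP); rewrite /ball -sz take_size.
apply: gdist_ge => [|p vp px].
  (* [gdist_ge] asks for [r.+1 <= n]; the reached vertices are distinct and more than
     [ball_edges r.+1] in number. *)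
  have := max_card (mem (reached v ys)); rewrite card_ord (card_uniqP uR) /= size_map sz.
  by apply: leq_trans; apply: leq_trans (ball_edges_ge _) _.
rewrite ltnNge; apply: contra xNr => le_p; rewrite -px.
apply: (ball_mono le_p); apply: path_ball vp => //.
by rewrite sz ball_edges_le // leqW.
Qed.

(* A cycle through the pendant vertex [y.1] would enter and leave it by the same
   edge. *)
Lemma acyclic_pendant F q y : q.1 != y.1 -> (forall h, h \in cover F -> h.1 != y.1) ->
  (forall p, ~ is_cycle F p) -> forall p, ~ is_cycle ([set q; y] |: F) p.
Proof.
move=> qy Fy acF p [p0 u1 u2 sF cp].
have JF B x x' : B \in [set q; y] |: F -> joins B x x' -> (x == y.1) || (x' == y.1) ->
    B = [set q; y].
  rewrite in_setU1 => /orP[/eqP//|BF] J xy; exfalso.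
  have [h1 h1B h1x] := joins_mem J; rewrite joins_sym in J.
  have [h2 h2B h2x] := joins_mem J.
  have [h1F h2F] : h1 \in cover F /\ h2 \in cover F by split; apply/bigcupP; exists B.
  by move: xy; rewrite -h1x -h2x (negPf (Fy _ h1F)) (negPf (Fy _ h2F)).
have [/mapP[z zp zy]|yNp] := boolP (y.1 \in unzip1 p); last first.
  apply: (acF p); split=> // B /mapP[z zp ->].
  have := sF _ (map_f snd zp); rewrite in_setU1 => /orP[/eqP eqB|//].
  have J := next_cycle cp zp; rewrite /= eqB in J.
  case/negP: yNp; have [->|->] := joins_end J (set22 q y); first exact: map_f.
  by apply: map_f; rewrite mem_next.
(* Rotated to start at [y.1], the cycle has the new pair as first and as last edge; if these are the
   same, it is a loop and [q.1 = y.1]. *)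
have [i p' rot_p] := rot_to zp.
have {}cp : cycle (fun a b => joins a.2 a.1 b.1) (z :: p') by rewrite -rot_p rot_cycle.
have {}sF : {subset unzip2 (z :: p') <= [set q; y] |: F}.
  by move=> B; rewrite -rot_p /unzip2 map_rot mem_rot; apply: sF.
have {}u2 : uniq (unzip2 (z :: p')) by rewrite -rot_p /unzip2 map_rot rot_uniq.
case/lastP: p' {rot_p} => [|p' w] in cp sF u2.
  move: cp; rewrite /= andbT -zy => J.
  have eqB := JF _ _ _ (sF _ (mem_head _ _)) J; rewrite eqB ?eqxx // in J.
  by have [/eqP|/eqP] := joins_end J (set21 q y); rewrite (negPf qy).
have zB : z.2 = [set q; y].
  case: p' => [|w' p'] in cp sF u2; move: cp => /= /andP[J _];
  by apply: JF J _; rewrite ?sF ?mem_head // -zy eqxx.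
have wB : w.2 = [set q; y].
  move: cp; rewrite /= rcons_path last_rcons => /andP[_ J].
  apply: JF J _; last by rewrite -zy eqxx orbT.
  by apply/sF/map_f; rewrite in_cons mem_rcons mem_head orbT.
by move: u2; rewrite /= /unzip2 map_rcons mem_rcons zB wB mem_head.
Qed.

Lemma edges_acyclic v ys p : uniq (reached v ys) -> ~ is_cycle [set:: edges v ys] p.
Proof.
elim/last_ind: ys p => [|ys y IH] p.
  move=> _ [p0 _ _ sF _]; case: p => // z p in p0 sF *.
  by have := sF _ (mem_head _ _); rewrite inE edges_nil.
rewrite reached_rcons rcons_uniq edges_rcons_set => /andP[yR uR].
apply: acyclic_pendant => [|h /cover_reached hR|p']; last exact: IH.
  by apply: contra yR => /eqP <-; apply: mem_frontier.
by apply: contra yR => /eqP <-.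
Qed.

Lemma connect_reached v ys x :
  x \in reached v ys -> connect (adj [set:: edges v ys]) v x.
Proof.
elim/last_ind: ys x => [|ys y IH] x; first by rewrite mem_seq1 => /eqP->.
rewrite reached_rcons mem_rcons edges_rcons_set => xR.
have sub : subrel (connect (adj [set:: edges v ys]))
    (connect (adj ([set frontier v ys y; y] |: [set:: edges v ys]))).
  by apply: connect_sub => a b ab; apply/connect1/(adj_sub _ ab)/subsetUr.
move: xR; rewrite in_cons => /orP[/eqP->|/IH/sub//].
apply: connect_trans (sub _ _ (IH _ (mem_frontier v ys y))) (connect1 _).
by apply/existsP; exists [set frontier v ys y; y]; rewrite setU11 joins_pair.
Qed.

(** * Degrees in the search tree *)

Lemma card_star x : #|[set h : half_edge n d | h.1 == x]| = d.
Proof.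
have -> : [set h : half_edge n d | h.1 == x] = setX [set x] [set: 'I_d].
  by apply/setP => h; rewrite !inE andbT.
by rewrite cardsX cards1 cardsT card_ord mul1n.
Qed.

Lemma take_queue_ball v ys r : size ys = ball_edges r.+1 ->
  take (size ys) (queue v ys) = queue v (take (ball_edges r) ys).
Proof.
move=> sz; rewrite (queue_take v ys (ball_edges r)) take_size_cat //.
by rewrite size_queue_ball // sz ltnW // ball_edges_lt.
Qed.

Lemma degree_inner v ys r x : size ys = ball_edges r.+1 ->
  x \in ball v ys r -> degree [set:: edges v ys] x = d.
Proof.
move=> sz xr; rewrite -[RHS](card_star x); apply: eq_card => h; rewrite !inE.
case: eqP => [hx|_]; rewrite ?andbF // andbT mem_cover_edges (take_queue_ball v sz).
have : h.1 \in ball v ys r by rewrite hx.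
by rewrite -mem_queue => /orP[->|/mem_take ->]; rewrite ?orbT.
Qed.

(** No half-edge of the outer level has been processed, so only partners are covered there, and
    distinct partners lie at distinct vertices. *)
Lemma degree_outer v ys r x : uniq (reached v ys) -> size ys = ball_edges r.+1 ->
  x \notin ball v ys r -> degree [set:: edges v ys] x <= 1.
Proof.
move=> /= /andP[_ u1] sz xNr; apply/card_le1_eqP => h h'.
have in_ys k : k \in [set k in cover [set:: edges v ys] | k.1 == x] -> k \in ys /\ k.1 = x.
  rewrite inE mem_cover_edges (take_queue_ball v sz) => /andP[kE /eqP kx]; split=> //.
  by case/orP: kE xNr => // kq; rewrite -kx -mem_queue kq.
move=> /in_ys[/(nthP h)[i lti <-] hx] /in_ys[/(nthP h)[j ltj <-] h'x].
congr nth; apply/eqP; rewrite -(nth_uniq x _ _ u1) ?size_map //.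
by rewrite !(nth_map h) // hx h'x.
Qed.

Lemma explores_radius P v r : P \in configurations n d ->
  explores P v (ball_edges r) -> r <= largest_radius P v.
Proof.
case: r => // r PM /exploresP[ys sz [uR sP]].
pose T : subgraph n d := ([set:: reached v ys], [set:: edges v ys]).
have sphere u : u \in T.1 -> u \notin ball v ys r -> gdist P v u = r.+1.
  by rewrite inE; apply: gdist_sphere.
(* The partner of index [ball_edges r] is the first one on the outer level; its vertex shows that
   the radius [r.+1] is attained. *)
have [u uT uNr] : exists2 u, u \in T.1 & u \notin ball v ys r.
  have: size (drop (ball_edges r) ys) != 0.
    by rewrite size_drop sz -lt0n subn_gt0 ball_edges_lt.
  move: uR; rewrite /ball -{1}(cat_take_drop (ball_edges r) ys) /reached.
  case defD: (drop _ _) => [|y s] //.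
  rewrite /unzip1 map_cat -cat_cons cat_uniq => /and3P[_ /hasPn yN _] _.
  exists y.1; last by apply: yN; apply: mem_head.
  rewrite inE in_cons map_f ?orbT // -(cat_take_drop (ball_edges r) ys).
  by rewrite defD mem_cat mem_head orbT.
have radT : radius P v T = r.+1.
  apply/eqP; rewrite eqn_leq; apply/andP; split.
    apply/bigmax_leqP => x; rewrite inE => xR.
    by apply: (gdist_ball sP); rewrite /ball -sz take_size.
  by rewrite -(sphere u uT uNr); apply: leq_bigmax_cond.
rewrite -radT; apply: leq_bigmax_cond; apply/asboolP; split.
- split; first by apply/subsetP => B; rewrite inE; apply: sP.
  by move=> h /cover_reached hR; rewrite in_set.
- split; last by move=> p; apply: edges_acyclic.
  move=> x x'; rewrite !in_set => /connect_reached cx /connect_reached cx'.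
  by apply: connect_trans cx'; rewrite (sym_connect_sym (@adj_sym _)).
- by rewrite inE mem_head.
- move=> x xT nleaf; apply: (degree_inner sz).
  by apply/negP => /negP xNr; case: nleaf; split=> //; apply: degree_outer xNr.
- move=> x [xT deg1]; rewrite radT; apply: sphere => //.
  by apply/negP => /(degree_inner sz) degd; move: deg1; rewrite degd leqNgt ltnW.
Qed.

(* The edge [B] that will close the path into a cycle is left arbitrary. *)
Lemma path_edges F x p : path (adj F) x p -> uniq (x :: p) ->
  exists c : seq ('I_n * {set half_edge n d}),
  [/\ unzip1 c = belast x p, {subset unzip2 c <= F}, uniq (unzip2 c),
      forall z, z \in c -> exists x1 x2,
        [/\ x1 \in x :: p, x2 \in x :: p & joins z.2 x1 x2]
    & forall B, sorted (fun a b => joins a.2 a.1 b.1) (rcons c (last x p, B))].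
Proof.
elim: p x => [|x' p IH] x; first by exists [::].
rewrite [path _ _ _]/= => /andP[/existsP[B /andP[BF J]] x'p].
rewrite cons_uniq => /andP[xNp /(IH _ x'p)[c [u1 sF u2 Jc sc]]].
exists ((x, B) :: c); split.
- by rewrite /= u1.
- by move=> C; rewrite in_cons => /orP[/eqP->|/sF].
- rewrite /= u2 andbT; apply: contra xNp => /mapP[z zc defB].
  have [x1 [x2 [x1p x2p Jz]]] := Jc z zc.
  have [h hB <-] := joins_mem J; rewrite /= defB in hB.
  by have [->|->] := joins_end Jz hB.
- move=> z; rewrite in_cons => /orP[/eqP->|/Jc[x1 [x2 [x1p x2p Jz]]]].
    by exists x, x'; rewrite mem_head in_cons mem_head orbT.
  by exists x1, x2; rewrite in_cons x1p in_cons x2p !orbT.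
move=> C; have := sc C; case: c u1 {sF u2 Jc sc} => [|[a A] c] /=.
  by case: p {IH x'p xNp} => //= _; rewrite J.
by case: p {IH x'p xNp} => //= b p [-> _] ->; rewrite J.
Qed.

(** A walk in [F] shortens to a simple path, which [B] closes up; for the empty path [B] is a
    loop. *)
Lemma connect_cycle F P B x x' : F \subset P -> B \in P -> B \notin F ->
  connect (adj F) x x' -> joins B x' x -> exists p, is_cycle P p.
Proof.
move=> sFP BP BNF /connectP[p0 /shortenP[p xp up _] ->{x'}] J.
have [c [u1 sF u2 _ sc]] := path_edges xp up.
exists (rcons c (last x p, B)); split.
- by case: c {u1 sF u2 sc}.
- by rewrite /unzip1 map_rcons -/(unzip1 c) u1 -lastI.
- by rewrite /unzip2 map_rcons rcons_uniq u2 andbT; apply: contra BNF => /sF.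
- move=> C; rewrite /unzip2 map_rcons mem_rcons in_cons => /orP[/eqP->//|/sF].
  exact: (subsetP sFP).
have := sc B; case: c u1 {sF u2 sc} => [|z c] u1 /=; first by case: p {xp up} u1 J => //= _ ->.
rewrite !rcons_path last_rcons => -> /=.
by case: p {xp up} u1 J => //= b p [-> _].
Qed.

(* If a partner lay at a vertex already reached, its pair would close a cycle
   in [T]. *)
Lemma radius_explores P v T k : P \in configurations n d -> regular_tree_at P v T ->
  k <= ball_edges (radius P v T) -> 
  exists ys, [/\ size ys = k, uniq (reached v ys) & {subset edges v ys <= T.2}].
Proof.
move=> PM [[sTP sT] [_ acT] vT degT leafT]; elim: k => [|k IH] le_k.
  by exists [::]; split=> // B; rewrite edges_nil.
have [ys [sz uR sE]] := IH (ltnW le_k).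
have reachedT x : x \in reached v ys -> x \in T.1.
  rewrite in_cons => /orP[/eqP->//|/mapP[y yys ->]]; apply: sT.
  have : y \in cover [set:: edges v ys] by rewrite mem_cover_edges yys orbT.
  by case/bigcupP => B; rewrite inE => /sE BT yB; apply/bigcupP; exists B.
case defR: (radius P v T) => [|r] in le_k; first by [].
(* A default for [frontier], since the partner [y] of [q] is not known yet. *)
pose h0 := (v, Ordinal (ltn_trans (isT : 0 < 2) d_gt2)).
pose q := frontier v ys h0.
have qb : q.1 \in ball v ys r.
  by rewrite -mem_queue nth_queue_ball ?sz.
have qT : q.1 \in T.1 by apply: reachedT; apply: mem_frontier.
have sEP : {subset edges v ys <= P} by move=> B /sE; apply: (subsetP sTP).
(* A leaf would be at distance [r.+1] from [v], but [q.1] is at distance at most [r]. *)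
have degq : degree T.2 q.1 = d.
  apply: degT => // /leafT eq_g; have := gdist_ball sEP qb.
  by rewrite eq_g defR ltnn.
(* Degree [d] means that [T.2] covers all half-edges at [q.1], so the pair containing [q] is an edge
   of the tree. *)
have /bigcupP[B BT qB] : q \in cover T.2.
  have /setP/(_ q) : [set h in cover T.2 | h.1 == q.1] = [set h | h.1 == q.1].
    apply/eqP; rewrite eqEcard card_star; apply/andP; split.
      by apply/subsetP => h; rewrite !inE => /andP[].
    by move: degq; rewrite /degree => ->.
  by rewrite !inE eqxx andbT.
have BP := subsetP sTP _ BT.
have [y defB] := matching_block PM BP qB.
have qy : frontier v ys y = q by apply: set_nth_default; apply: size_queue_gt.
exists (rcons ys y); split; first by rewrite size_rcons sz.
  rewrite reached_rcons rcons_uniq uR andbT; apply/negP => yR.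
  have connR x : x \in reached v ys -> connect (adj [set:: edges v ys]) v x.
    exact: connect_reached.
  have [||||p /acT//] := @connect_cycle [set:: edges v ys] T.2 B y.1 q.1 _ BT.
  - by apply/subsetP => C; rewrite inE => /sE.
  - apply: contra (frontier_fresh h0 uR) => BE.
    by apply/bigcupP; exists B.
  - apply: connect_trans (connR _ (mem_frontier v ys h0)).
    by rewrite (sym_connect_sym (@adj_sym _)) connR.
  - by rewrite defB joins_pair.
move=> C; rewrite edges_rcons mem_rcons in_cons => /orP[/eqP->|/sE//].
by rewrite qy -defB.
Qed.

Lemma largest_radiusP P v r : P \in configurations n d ->
  (r <= largest_radius P v) = explores P v (ball_edges r).
Proof.
move=> PM; apply/idP/idP; last exact: explores_radius.
case: r => [|r] => [_|].
  by apply/exploresP; exists [::]; split=> // B; rewrite edges_nil.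
(* By contraposition: a tree of radius above [r] would carry a successful search of
   [ball_edges r.+1] steps. *)
apply: contraLR => nexp; rewrite -leqNgt; apply/bigmax_leqP => T /asboolP rT.
rewrite leqNgt; apply: contra nexp => /ball_edges_le/(radius_explores PM rT)[ys [sz uR sE]].
apply/exploresP; exists ys => //; split=> // B /sE.
by case: rT => -[/subsetP sTP _] _ _ _ _; apply: sTP.
Qed.

End Exploration.

Import Order.TTheory GRing.Theory Num.Theory.
Local Open Scope ring_scope.

(** * The probability that the search succeeds *)

Section Probability.
Variables (R : realFieldType) (n d : nat).
Hypothesis d_gt2 : (2 < d)%N.
Hypothesis dn_even : ~~ odd (d * n).
Variable v : 'I_n.
Implicit Types (E : pred {set {set half_edge n d}}) (k r : nat).

Local Notation prob_explores k :=
  (config_prob R (fun P : {set {set half_edge n d}} => explores P v k)).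

Lemma n_gt0 : (0 < n)%N.
Proof. exact: leq_ltn_trans (leq0n v) (ltn_ord v). Qed.

Lemma config_card k : (k.*2 <= n * d)%N ->
  (n * d = ((n * d)./2 - k).*2 + k.*2)%N.
Proof. by move: dn_even; rewrite mulnC; lia. Qed.

Lemma card_explores_config k : (k.*2 <= n * d)%N ->
  #|[set P in configurations n d | explores P v k]| =
  (d ^ k * n.-1 ^_ k * \prod_(i < (n * d)./2 - k) i.*2.+1)%N.
Proof. by move=> le_k; apply: card_explores_mul => //; apply: config_card. Qed.

Lemma configurations_gt0 : (0 < #|configurations n d|)%N.
Proof.
(* For [k = 0] the count is a product of odd numbers, hence positive. *)
have le0 : (0.*2 <= n * d)%N by [].
apply: leq_trans (subset_leq_card (_ : [set P in configurations n d | explores P v 0] \subset _)).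
  by rewrite (card_explores_config le0) expn0 ffactn0 !mul1n prodn_gt0.
by apply/subsetP => P; rewrite inE => /andP[].
Qed.

Lemma config_prob_ge0 E : 0 <= config_prob R E.
Proof. by rewrite /config_prob divr_ge0 ?ler0n. Qed.

Lemma config_prob_le1 E : config_prob R E <= 1.
Proof.
rewrite /config_prob ler_pdivrMr ?ltr0n ?configurations_gt0 // mul1r ler_nat.
by apply/subset_leq_card/subsetP => P; rewrite in_set => /andP[].
Qed.

Lemma config_prob_setD E E1 E2 :
  (forall P, P \in configurations n d -> E1 P -> ~~ E2 P -> E P) ->
  config_prob R E1 - config_prob R E2 <= config_prob R E.
Proof.
move=> sub; rewrite lerBlDr /config_prob -mulrDl ler_wpM2r ?invr_ge0 ?ler0n //.
rewrite -natrD ler_nat; apply: leq_trans (leq_card_setU _ _).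
apply/subset_leq_card/subsetP => P; rewrite in_set => /andP[PM E1P].
rewrite in_setU; case: (boolP (E2 P)) => [E2P|/(sub _ PM E1P) EP]; apply/orP.
  by right; rewrite in_set PM.
by left; rewrite in_set PM.
Qed.

Lemma prob_explores0 : prob_explores 0 = 1.
Proof.
apply/eqP; rewrite eq_le config_prob_le1 /config_prob.
rewrite ler_pdivlMr ?ltr0n ?configurations_gt0 // mul1r ler_nat.
apply/subset_leq_card/subsetP => P PM; rewrite in_set PM /=.
by apply/exploresP; exists [::]; split=> // B; rewrite edges_nil.
Qed.

Lemma prob_explores_oversize k : (n <= k)%N -> prob_explores k = 0.
Proof.
move=> le_k; rewrite /config_prob.
have -> : [set P in configurations n d | explores P v k] = set0.
  apply/setP => P; rewrite in_set in_set0; apply/negP => /andP[_ /exploresP[ys sz [uR _]]].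
  have := max_card (mem (reached v ys)); rewrite card_ord (card_uniqP uR) /= size_map sz.
  by rewrite leqNgt ltnS le_k.
by rewrite cards0 mul0r.
Qed.

(* Step [k] of a successful search may pick any of the [d * (n.-1 - k)]
   half-edges at fresh vertices among the [d * n - 2 * k - 1] unmatched ones. *)
Lemma prob_exploresS k : (k < n)%N ->
  prob_explores k.+1 * (d%:R * n%:R - k%:R *+ 2 - 1) =
  prob_explores k * (d%:R * (n%:R - 1 - k%:R)).
Proof.
move=> lt_k; have le_k : (k.+1.*2 <= n * d)%N by nia.
rewrite /config_prob mulrAC [RHS]mulrAC; congr (_ * _).
rewrite (card_explores_config le_k) card_explores_config; last by lia.
(* After [k] steps [m.+1] pairs are left; the factor [m.*2.+1] that splits off is
   [d n - 2 k - 1]. *)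
have [m eq_m] : exists m, ((n * d)./2 - k = m.+1)%N.
  by exists ((n * d)./2 - k.+1)%N; move: le_k; lia.
have -> : ((n * d)./2 - k.+1 = m)%N by lia.
rewrite eq_m big_ord_recr /= expnS ffactnSr !natrM.
have -> : (n.-1 - k)%:R = n%:R - 1 - k%:R :> R.
  have <- : (n.-1 - k)%:R + 1 + k%:R = n%:R :> R by rewrite natr1 -natrD; congr _%:R; lia.
  by rewrite addrAC !addrK.
have -> : m.*2.+1%:R = d%:R * n%:R - k%:R *+ 2 - 1 :> R.
  have eq_nd : (d * n = m.*2.+1 + k.*2 + 1)%N.
    by have := dn_even; rewrite mulnC in eq_m le_k *; lia.
  by rewrite -natrM eq_nd !natrD -!muln2 !natrM; ring.
by ring.
Qed.

(** While [2 k < n], step [k] lowers the probability by at most [2 (k + 1) / n], and these losses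
    add up to at most [2 k^2 / n]. *)
Lemma prob_explores_ge k : 1 - 2 * k%:R ^+ 2 / n%:R <= prob_explores k.
Proof.
have n0 : 0 < n%:R :> R by rewrite ltr0n n_gt0.
elim: k => [|k IH]; first by rewrite expr0n /= mulr0 mul0r subr0 prob_explores0.
(* For [n <= 2 k] the claimed lower bound is not positive. *)
have [lt_n|le_n] := ltnP k.*2 n; last first.
  apply: le_trans (config_prob_ge0 _); rewrite subr_le0 ler_pdivlMr // mul1r.
  rewrite -natrX -natrM ler_nat; nia.
have lt_k : (k < n)%N by lia.
have := prob_exploresS lt_k.
have := config_prob_le1 (fun P => explores P v k).
move: IH; set p := config_prob _ _; set p' := config_prob _ _.
set N : R := n%:R; set K : R := k%:R; set D := d%:R * N - K *+ 2 - 1 => IH p1 eq_p.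
have ge0K : 0 <= K by rewrite ler0n.
have d2 : 2 <= d%:R :> R by rewrite ler_nat ltnW.
have le_dN : 4 * K + 2 <= d%:R * N.
  by rewrite -!natrM -!natrD ler_nat; nia.
have D0 : 0 < D by rewrite /D mulr2n; lra.
(* [T = d (K + 1) - 2 K - 1] counts the unmatched half-edges at reached vertices other than the
   frontier, so [T / D] is the chance that the step fails. *)
set T := (d%:R - 2) * (K + 1) + 1.
have T0 : 0 <= T by rewrite /T addr_ge0 // mulr_ge0; lra.
have leT : N * T <= 2 * (K + 1) * D.
  have h1 : 0 <= (K + 1) * (d%:R * N - 4 * K - 2) by rewrite mulr_ge0; lra.
  have h2 : 0 <= N * (2 * K + 1) by rewrite mulr_ge0; lra.
  by rewrite /D /T mulr2n; lra.
have clear_denom x y : (1 - x / N <= y) = (N - x <= N * y).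
  by rewrite -(ler_pM2l n0) mulrBr mulr1 mulrCA divff ?gt_eqF // mulr1.
rewrite clear_denom in IH; rewrite clear_denom -natr1 -/K.
suff : N * p - 2 * (K + 1) <= N * p' by have := sqr_ge0 K; rewrite !expr2; lra.
rewrite -(ler_pM2r D0) [X in X <= _]mulrBl -[N * p' * D]mulrA eq_p.
have -> : d%:R * (N - 1 - K) = D - T by rewrite /D /T mulr2n; ring.
clearbody D T; have lepT := ler_wpM2l (ltW n0) (ler_piMl T0 p1).
rewrite mulrBr mulrBr [N * (p * D)]mulrA lerD2l lerN2.
exact: le_trans lepT leT.
Qed.

(** Step [k] multiplies the probability by at most [1 - s] with [s = (k + 1) / (d n)], and
    [(1 - s) (1 + S + s) <= 1 + S]. The terms [s] add up to [k (k + 1) / (2 d n)]. *)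
Lemma prob_explores_le k :
  prob_explores k * (1 + k%:R * k.+1%:R / (2 * d%:R * n%:R)) <= 1.
Proof.
have [le_n|lt_n] := leqP n k; first by rewrite prob_explores_oversize // mul0r.
have N0 : 0 < n%:R :> R by rewrite ltr0n n_gt0.
have d3 : 3 <= d%:R :> R by rewrite ler_nat.
elim: k lt_n => [|k IH] lt_n; first by rewrite prob_explores0 !mul0r addr0 mul1r.
apply: le_trans (IH (ltnW lt_n)); have := prob_exploresS (ltnW lt_n).
have := config_prob_ge0 (fun P => explores P v k).
set p := config_prob _ _; set p' := config_prob _ _.
set N : R := n%:R; set K : R := k%:R; set D := d%:R * N - K *+ 2 - 1 => p0 eq_p.
have ge0K : 0 <= K by rewrite ler0n.
have leK : K + 1 <= N by rewrite natr1 ler_nat ltnW.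
have D0 : 0 < D by rewrite /D mulr2n; nra.
have defp' : p' = p * (d%:R * (N - 1 - K)) / D by rewrite -eq_p mulfK ?gt_eqF.
set M := 2 * d%:R * N; set T := (d%:R - 2) * (K + 1) + 1.
have M0 : 0 < M by rewrite /M; nra.
have T0 : K + 1 <= T by rewrite /T; nra.
have leD : 2 * D <= M by rewrite /M /D mulr2n; lra.
have eqX : d%:R * (N - 1 - K) = D - T by rewrite /D /T mulr2n; ring.
rewrite defp' eqX -!natr1 -/K -[p * _ / D]mulrA -mulrA ler_wpM2l //.
clearbody D T; have leX : (D - T) / D <= 1 - 2 * (K + 1) / M.
  rewrite mulrBl divff ?gt_eqF // lerD2l lerN2 ler_pdivrMr // mulrAC ler_pdivlMr //.
  have h1 : 0 <= (T - (K + 1)) * M by rewrite mulr_ge0; lra.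
  have h2 : 0 <= (K + 1) * (M - 2 * D) by rewrite mulr_ge0; lra.
  by lra.
set s := 2 * (K + 1) / M in leX; set S := K * (K + 1) / M.
have -> : (K + 1) * (K + 1 + 1) / M = S + s by rewrite /S /s; ring.
have S0 : 0 <= S by rewrite /S divr_ge0 ?mulr_ge0; lra.
have s0 : 0 <= s by rewrite /s divr_ge0 ?mulr_ge0; lra.
apply: le_trans (ler_wpM2r _ leX) _; first by lra.
by nra.
Qed.

(** Follows from [(k + 1)^2 <= 2 (M + k (k + 1))] with [M = 2 d n]; the form with [k.+1] fits
    [ball_edges_lower]. *)
Lemma prob_explores_upper k :
  prob_explores k * k.+1%:R ^+ 2 <= 4 * d%:R * n%:R.
Proof.
have N0 : 0 < n%:R :> R by rewrite ltr0n n_gt0.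
have d3 : 3 <= d%:R :> R by rewrite ler_nat.
have := prob_explores_le k; have := config_prob_ge0 (fun P => explores P v k).
set p := config_prob _ _ => p0; set M := 2 * d%:R * n%:R.
have M0 : 0 < M by rewrite /M; nra.
move=> le_p; have {}le_p : p * (M + k%:R * k.+1%:R) <= M.
  have := ler_wpM2r (ltW M0) le_p.
  by rewrite mul1r -[p * _ * M]mulrA mulrDl mul1r divfK // gt_eqF.
have -> : 4 * d%:R * n%:R = 2 * M by rewrite /M; ring.
have M1 : 1 <= M by rewrite /M -!natrM ler1n; have := n_gt0; lia.
apply: le_trans (_ : p * (2 * (M + k%:R * k.+1%:R)) <= _); last by rewrite mulrCA ler_pM2l.
apply: ler_wpM2l => //; rewrite -natr1; have : 0 <= k%:R :> R by rewrite ler0n.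
by rewrite expr2; nra.
Qed.

(** [E] contains the event that the search survives [k] steps but not [m], whose probability is at
    least the difference of the two. *)
Lemma explores_window k m E :
  (forall P, P \in configurations n d -> explores P v k -> ~~ explores P v m -> E P) ->
  1 - 2 * k%:R ^+ 2 / n%:R - 4 * d%:R * n%:R / m.+1%:R ^+ 2 <= config_prob R E.
Proof.
move=> /config_prob_setD; apply: le_trans; apply: lerB; first exact: prob_explores_ge.
by rewrite ler_pdivlMr ?prob_explores_upper // exprn_gt0 ?ltr0n.
Qed.
End Probability.

(** * Growth of the ball sizes *)

Section BallSize.
Variable d : nat.
Hypothesis d_gt2 : (2 < d)%N.

Lemma ball_edges_lower r : (d.-1 ^ r <= (ball_edges d r).+1)%N.
Proof. by elim: r => // r IH; rewrite expnS /=; nia. Qed.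

Lemma ball_edges_upper r : (ball_edges d r <= 3 * d.-1 ^ r)%N.
Proof.
(* The summand 3 absorbs the [d] of the recurrence, as [6 <= 2 d]. *)
suff : (ball_edges d r + 3 <= 3 * d.-1 ^ r)%N by lia.
by elim: r => // r IH; rewrite expnS /=; nia.
Qed.
End BallSize.

(* The window around half the logarithm *)
From mathcomp Require Import all_classical all_reals all_analysis.
Import numFieldNormedType.Exports.
Local Open Scope classical_set_scope.

Lemma ln_nat_large (R : realType) (A : R) : \forall n \near \oo, A <= ln (n%:R : R).
Proof.
near=> n; rewrite -[A]expRK ler_ln ?posrE ?expR_gt0 //; last first.
  by apply: lt_le_trans (expR_gt0 A) _; near: n; apply: nbhs_infty_ger.
by near: n; apply: nbhs_infty_ger.
Unshelve. all: by end_near. Qed.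

Lemma natrX_expR (R : realType) (b r : nat) :
  (0 < b)%N -> (b ^ r)%:R = expR (r%:R * ln (b%:R : R)).
Proof. by move=> b0; rewrite expRM_natl lnK ?posrE ?ltr0n // natrX. Qed.

(** With [h = sqrt (ln n)], moving the radius by [h / ln (d - 1)] changes [(d - 1)^r] by the factor
    [expR h]. Both error terms are then of order [expR (- 2 h)], bounded crudely by [1 / h]. *)
Lemma largest_radius_window (R : realType) (n d : nat) (v : 'I_n) :
  (2 < d)%N -> ~~ odd (d * n) -> 4 <= ln (n%:R : R) ->
  1 - (18 * (d.-1)%:R ^+ 2 + 4 * d%:R) / Num.sqrt (ln n%:R) <=
  config_prob R (fun P : {set {set half_edge n d}} =>
    let log_n : R := ln n%:R / ln (d.-1)%:R in
    `| (largest_radius P v)%:R - 2^-1 * log_n | <= (Num.sqrt (ln n%:R))^-1 * log_n).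
Proof.
move=> d_gt2 dn_even; set N := ln n%:R => N4 /=.
set b := d.-1; set h := Num.sqrt N; set l := ln b%:R.
have b_gt1 : (1 < b)%N by rewrite /b; lia.
have n0 : 0 < n%:R :> R by rewrite ltr0n (leq_ltn_trans (leq0n v)).
have l0 : 0 < l by rewrite ln_gt0 // ltr1n.
have hh : h * h = N by rewrite -expr2 sqr_sqrtr //; apply: le_trans N4.
(* This makes [ln n / 2 - h = h (h / 2 - 1)] nonnegative, so that truncating [x1] is rounding
   down. *)
have h2 : 2 <= h.
  have h_ge0 : 0 <= h := sqrtr_ge0 N.
  by rewrite leNgt; apply/negP => lt_h; nra.
have -> : h^-1 * (N / l) = h / l by rewrite mulrA -hh mulKf // gt_eqF //; lra.
pose x1 := (2^-1 * N - h) / l; pose x2 := (2^-1 * N + h) / l.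
have x1_ge0 : 0 <= x1 by rewrite divr_ge0 ?(ltW l0) // -hh; nra.
have x2_ge0 : 0 <= x2 by rewrite divr_ge0 ?(ltW l0) // -hh; nra.
pose t1 := Num.truncn x1; pose t2 := Num.truncn x2.
have [le_t1 lt_t1] := andP (Num.Theory.truncn_itv x1_ge0).
have [le_t2 lt_t2] := andP (Num.Theory.truncn_itv x2_ge0).
(* Success at radius [t1.+1 > x1] and failure at [t2.+1] confine the largest radius to
   [t1 < r <= t2], hence to the interval from [x1] to [x2]. *)
apply: le_trans (explores_window R d_gt2 dn_even (v := v)
  (k := ball_edges d t1.+1) (m := ball_edges d t2.+1) _); last first.
  move=> P PM; rewrite -!largest_radiusP // -leqNgt => le_r ge_r.
  have -> : 2^-1 * (N / l) = 2^-1 * N / l by rewrite mulrA.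
  rewrite ler_distl -mulrBl -mulrDl -/x1 -/x2; apply/andP; split.
    by apply: le_trans (ltW lt_t1) _; rewrite ler_nat.
  by apply: le_trans le_t2; rewrite ler_nat.
pose s := expR (2^-1 * N); pose E := expR h.
have [s0 E0] : 0 < s /\ 0 < E by split; apply: expR_gt0.
have h0 : 0 < h by apply: lt_le_trans h2.
have le_hE : h <= E * E.
  have le_E : 1 + h <= E := expR_ge1Dx h.
  have le_h : h <= E by apply: le_trans le_E; rewrite lerDr.
  by apply: le_trans le_h _; rewrite ler_peMr ?(ltW E0) // (le_trans _ le_E) // lerDl ltW.
have ss : s * s = n%:R.
  rewrite -expRD -mulrDl; have -> : 2^-1 + 2^-1 = 1 :> R by lra.
  by rewrite mul1r lnK.
have b_pos : (0 < b)%N by apply: ltnW.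
have b1 : (b ^ t1)%:R <= s / E.
  rewrite natrX_expR // -expRN -expRD ler_expR -/l.
  by rewrite -ler_pdivlMr.
have b2 : s * E <= (b ^ t2.+1)%:R.
  rewrite natrX_expR // -expRD ler_expR -/l.
  by rewrite -ler_pdivrMr // ltW.
have k_le : (ball_edges d t1.+1)%:R <= 3 * b%:R * (s / E).
  apply: le_trans (_ : (3 * b ^ t1.+1)%:R <= _); first by rewrite ler_nat ball_edges_upper.
  by rewrite expnS !natrM -mulrA ler_wpM2l // ler_wpM2l.
have m_ge : s * E <= (ball_edges d t2.+1).+1%:R.
  by apply: le_trans b2 _; rewrite ler_nat ball_edges_lower.
have invE : (E * E)^-1 <= h^-1 by rewrite lef_pV2 ?posrE ?mulr_gt0.
rewrite -addrA lerD2l -opprD lerN2 [leRHS]mulrDl; apply: lerD.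
  (* The constant is [18 = 2 * 3^2], from the squared bound [k_le], with [n = s * s]. *)
  apply: le_trans (_ : 18 * b%:R ^+ 2 / (E * E) <= _); last first.
    by rewrite ler_wpM2l // mulr_ge0 // exprn_ge0.
  rewrite ler_pdivrMr // -ss.
  have -> : 18 * b%:R ^+ 2 / (E * E) * (s * s) = 2 * (3 * b%:R * (s / E)) ^+ 2.
    by rewrite !expr2; field; rewrite gt_eqF.
  rewrite ler_wpM2l //; apply: lerXn2r k_le; rewrite ?nnegrE //.
  by rewrite !mulr_ge0 ?invr_ge0 ?ler0n ?(ltW s0) ?(ltW E0).
apply: le_trans (_ : 4 * d%:R / (E * E) <= _); last by rewrite ler_wpM2l // mulr_ge0.
rewrite ler_pdivrMr ?exprn_gt0 ?ltr0n // [leRHS]mulrAC ler_pdivlMr ?mulr_gt0 // -ss.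
rewrite -[leLHS]mulrA ler_wpM2l ?mulr_ge0 // mulrACA -expr2; apply: lerXn2r m_ge;
  rewrite ?nnegrE //.
by rewrite mulr_ge0 ?(ltW s0) ?(ltW E0).
Qed.

Theorem theorem1 (R : realType) (d : nat) (hd : (3 <= d)%N) :
  exists eps : nat -> R,
    eps @ \oo --> (0 : R) /\
    forall eta : R, 0 < eta ->
      \forall n \near \oo, ~~ odd (d * n) -> forall v : 'I_n,
        1 - eta <=
        config_prob R (fun P : {set {set half_edge n d}} =>
          let log_n : R := ln n%:R / ln (d.-1)%:R in
          `| (largest_radius P v)%:R - 2^-1 * log_n | <= eps n * log_n).
Proof.
have sqrt_large (A : R) : 0 < A -> \forall n \near \oo, A <= Num.sqrt (ln (n%:R : R)).
  move=> A0; near=> n; rewrite -[A]ger0_norm ?(ltW A0) // -sqrtr_sqr ler_wsqrtr //.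
  by near: n; apply: ln_nat_large.
(* This choice tends to 0, while [eps n * ln n = sqrt (ln n)] still tends to infinity, which makes
   the error vanish. *)
exists (fun n => (Num.sqrt (ln (n%:R : R)))^-1); split.
  apply/cvgrPdist_le => e e0; near=> n.
  have le_e : e^-1 <= Num.sqrt (ln (n%:R : R)).
    by near: n; apply: sqrt_large; rewrite invr_gt0.
  rewrite sub0r normrN ger0_norm ?invr_ge0 ?sqrtr_ge0 //.
  rewrite -[e]invrK lef_pV2 // posrE ?invr_gt0 //.
  by apply: lt_le_trans le_e; rewrite invr_gt0.
move=> eta eta0; set C : R := 18 * (d.-1)%:R ^+ 2 + 4 * d%:R.
have C0 : 0 < C.
  by rewrite /C ltr_wpDl ?mulr_ge0 ?exprn_ge0 // mulr_gt0 ?ltr0n //; apply: ltn_trans hd.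
(* [n] is chosen before [v]: the error [C / sqrt (ln n)] is the same for all roots. *)
near=> n => dn_even v.
apply: le_trans (@largest_radius_window R n d v hd dn_even _); last first.
  by near: n; apply: ln_nat_large.
have le_h : C / eta <= Num.sqrt (ln (n%:R : R)).
  by near: n; apply: sqrt_large; rewrite divr_gt0.
rewrite lerD2l lerN2 -/C ler_pdivrMr; last by apply: lt_le_trans le_h; rewrite divr_gt0.
by rewrite mulrC -ler_pdivrMr.
Unshelve. all: by end_near. Qed.
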